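(* Let $a_0,\dots,a_m$ be non-negative integers satisfying $a_0\ge a_1+\cdots+a_m$. Then the border rank of the monomial $x_0^{a_0}x_1^{a_1}\cdots x_m^{a_m}$ (where $x_0,\dots,x_m$ are independent variables over $\mathbb C$) is $$\underline{R}(x_0^{a_0}x_1^{a_1}\cdots x_m^{a_m})=\prod_{i=1}^m(1+a_i).$$
   Context: $S^d\mathbb C^n$ denotes the space of complex homogeneous polynomials of degree $d$ in $n$ variables. The rank $R(\phi)$ of $\phi\in S^d\mathbb C^n$ is the smallest $r$ such that $\phi=\ell_1^d+\cdots+\ell_r^d$ for linear forms $\ell_j\in\mathbb C^n$. The border rank $\underline{R}(\phi)$ is the smallest $r$ such that $\phi$ lies in the Zariski closure in $S^d\mathbb C^n$ of the set of polynomials of rank at most $r$. *)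

(* Defs.v *)
From mathcomp Require Import all_boot all_order all_algebra.
From mathcomp Require Import reals.
From mathcomp Require Import complex.
From mathcomp Require Import mpoly.

Set Implicit Arguments.
Unset Strict Implicit.
Unset Printing Implicit Defensive.

Import GRing.Theory.
Local Open Scope ring_scope.

Definition is_smallest (P : nat -> Prop) (r : nat) : Prop :=
  P r /\ forall s, P s -> (r <= s)%N.

Section ZariskiTopology.
Context (K : fieldType) (V : vectType K).

(* Polynomial functions on V are polynomials in the coordinates with respect
   to a basis of V; the resulting topology does not depend on the basis. *)
Definition eval_poly_fun (f : {mpoly K[\dim {:V}]}) (v : V) : K :=
  f.@[fun i => coord (vbasis {:V}) i v].

Definition zariski_closed (Z : V -> Prop) : Prop :=
  exists I : {mpoly K[\dim {:V}]} -> Prop,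
    forall v, Z v <-> (forall f, I f -> eval_poly_fun f v = 0).

Definition zariski_closure (A : V -> Prop) (v : V) : Prop :=
  forall Z : V -> Prop,
    zariski_closed Z -> (forall w, A w -> Z w) -> Z v.

End ZariskiTopology.

Section Rank.
Context (K : fieldType) (n d : nat).

Definition sum_of_powers (phi : dhomog n.+1 K d) (r : nat) : Prop :=
  exists l : 'I_r -> dhomog n.+1 K 1,
    (phi : {mpoly K[n.+1]}) = \sum_(j < r) (l j : {mpoly K[n.+1]}) ^+ d.

Definition has_rank (phi : dhomog n.+1 K d) (r : nat) : Prop :=
  is_smallest (sum_of_powers phi) r.

Definition rank_at_most (r : nat) (phi : dhomog n.+1 K d) : Prop :=
  exists2 s, (s <= r)%N & has_rank phi s.

Definition has_border_rank (phi : dhomog n.+1 K d) (r : nat) : Prop :=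
  is_smallest (fun s => zariski_closure (rank_at_most s) phi) r.

End Rank.

Lemma monomial_homog (K : fieldType) (m : nat) (a : 'I_m.+1 -> nat) :
  (\prod_(i < m.+1) 'X_i ^+ a i : {mpoly K[m.+1]})
    \is (\sum_(i < m.+1) a i)%N.-homog.
Proof.
elim/big_rec2: _ => [|i d p _ hp]; first exact: dhomog1.
apply: dhomogM hp; rewrite -[X in X.-homog]mul1n; apply: dhomogMn.
by rewrite dhomogX; apply/eqP; apply: mdeg1.
Qed.

Definition monomial (K : fieldType) (m : nat) (a : 'I_m.+1 -> nat) :
    dhomog m.+1 K (\sum_(i < m.+1) a i)%N :=
  DHomog (monomial_homog K a).

(* Main.v *)
(* Lower bound: for l = sum l_i x_i, the normalized coefficients e! [x^e] l^d are
   d! l^e, so the catalecticant matrix with entries (b+c)! [x^(b+c)] phi has rank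
   at most r on sums of r powers, and its minors are Zariski-closed conditions.
   On x^a, with b over the monomials of degree a_1 + ... + a_m dividing x^a and
   c over the complements a - b, it is a! times the identity.

   Upper bound: choose weights w_(i,j), j <= a_i, such that sum_j w_(i,j) (j+1)^b
   is 0 for b < a_i and 1 for b = a_i. Then, with A = a_1 + ... + a_m,
     t^(-A) sum_J (prod_i w_(i,J_i)) (x_0 + t sum_i (J_i+1) x_i)^d
   is a polynomial curve in t, a sum of prod_i (1+a_i) powers for t <> 0, whose
   value at t = 0 is a nonzero multiple of x^a. *)
From HB Require Import structures.
Require Import Defs.
From mathcomp Require Import all_boot all_order all_algebra.
From mathcomp Require Import reals.
From mathcomp Require Import complex.
From mathcomp Require Import mpoly.
From mathcomp Require Import boolp ring.

Set Implicit Arguments.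
Unset Strict Implicit.
Unset Printing Implicit Defensive.

Import Order.TTheory GRing.Theory Num.Theory.
Local Open Scope ring_scope.

(** * Coefficients of powers of linear forms *)

Definition mfact n (e : 'X_{1..n}) : nat := (\prod_(i < n) (e i)`!)%N.

Lemma mfact_gt0 n (e : 'X_{1..n}) : (0 < mfact e)%N.
Proof. by apply: prodn_gt0 => i; apply: fact_gt0. Qed.

Lemma mfactDU n (e : 'X_{1..n}) i : mfact (e + U_(i)) = ((e i).+1 * mfact e)%N.
Proof.
rewrite /mfact (bigD1 i) //= [in RHS](bigD1 i) //= mnmDE mnm1E eqxx addn1 factS.
rewrite mulnA; congr (_ * _)%N; apply: eq_bigr => j /negbTE ji.
by rewrite mnmDE mnm1E eq_sym ji addn0.
Qed.

Lemma mderiv_linform_expr n (A : comNzRingType) (l : 'I_n -> A) i d :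
  mderiv i ((\sum_j l j *: 'X_j : {mpoly A[n]}) ^+ d.+1)
  = (d.+1%:R * l i) *: (\sum_j l j *: 'X_j) ^+ d.
Proof.
set q := \sum_j _; have dq : mderiv i q = (l i)%:MP.
  rewrite /q raddf_sum (bigD1 i) //= big1 => [|j /negbTE ji].
    rewrite mderivZ mderivX mnm1E eqxx addr0 scale1r -[(U_(i) - _)%MM]add0m.
    by rewrite addmBA ?lepm_refl // addmK mpolyX0 alg_mpolyC.
  by rewrite mderivZ mderivX mnm1E ji scale0r scaler0.
elim: d => [|d IH]; first by rewrite expr1 expr0 mul1r dq alg_mpolyC.
rewrite exprS mderivM dq IH mul_mpolyC -scalerAr -exprS -scalerDl.
by rewrite -[in RHS]nat1r mulrDl mul1r.
Qed.

(** The multinomial theorem without division. Differentiating in a variable that occurs in [e]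
    lowers the degree by one and produces matching factors on both sides, hence an induction on
    [d]. *)
Lemma mcoeff_linform_expr n (A : comNzRingType) (l : 'I_n -> A) d
    (e : 'X_{1..n}) : mdeg e = d ->
  ((\sum_j l j *: 'X_j : {mpoly A[n]}) ^+ d)@_e *+ mfact e
  = (\prod_i l i ^+ e i) *+ d`!.
Proof.
elim: d e => [|d IH] e.
  move=> /eqP; rewrite mdeg_eq0 => /eqP ->.
  by rewrite expr0 mcoeff1 eqxx /mfact !big1 // => i _; rewrite mnm0E.
move=> de; have [i ei] : exists i, (0 < e i)%N.
  apply/existsP; apply: contraPT de; rewrite negb_exists => /forallP e0.
  rewrite mdegE big1 // => i _.
  by have := e0 i; rewrite -eqn0Ngt => /eqP.
have defe : e = (e - U_(i) + U_(i))%MM.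
  by rewrite submK //; apply/mnm_lepP => j; rewrite mnm1E; case: eqP => // <-.
move: de; rewrite defe; move: (e - U_(i))%MM => {defe ei}e.
rewrite mdegD mdeg1 addn1 => -[de].
rewrite mfactDU mulrnA -mcoeff_deriv mderiv_linform_expr mcoeffZ -mulrnAr.
rewrite (IH _ de) factS mulrnA mulrnAr; congr (_ *+ _).
rewrite -mulrA -[in RHS]mulr_natl; congr (_ * _).
rewrite (bigD1 i) //= [in RHS](bigD1 i) //= mnmDE mnm1E eqxx addn1 exprSr.
rewrite mulrA [l i * _]mulrC; congr (_ * _); apply: eq_bigr => j /negbTE ji.
by rewrite mnmDE mnm1E eq_sym ji addn0.
Qed.

Lemma dhomog1_linform n (A : nzRingType) (p : {mpoly A[n]}) :
  p \is 1.-homog -> p = \sum_i p@_U_(i) *: 'X_i.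
Proof.
move=> hp; apply/mpolyP => e; rewrite raddf_sum /=.
under eq_bigr do rewrite mcoeffZ mcoeffX.
have [/mdeg1P[i /eqP ->]|ne1] := boolP (mdeg e == 1%N).
  rewrite (bigD1 i) //= eqxx mulr1 big1 ?addr0 // => j /negbTE ji.
  by rewrite eq_mnm1 ji mulr0.
rewrite (dhomog_nemf_coeff hp ne1) big1 // => i _.
by case: (U_(i)%MM =P e) ne1 => [<-|]; rewrite ?mdeg1 ?mulr0.
Qed.

(** * Zariski closure: determinantal conditions and limits along curves *)

Section ZariskiClosure.
Context (K : numFieldType) (V : vectType K).

Lemma eval_linear_form (f : {scalar V}) (v : V) :
  eval_poly_fun (\sum_(i < \dim {:V}) f (vbasis {:V})`_i *: 'X_i) v = f v.
Proof.
rewrite /eval_poly_fun raddf_sum [in RHS](coord_vbasis (memvf v)) raddf_sum.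
by apply: eq_bigr => i _; rewrite /= mevalZ mevalXU linearZ mulrC.
Qed.

(** Writing each linear form in coordinates makes the determinant a polynomial function, so its zero
    locus is closed. *)
Lemma zariski_closure_det N (M : 'I_N -> 'I_N -> {scalar V}) (A : V -> Prop) v :
  (forall w, A w -> \det (\matrix_(i, j) M i j w) = 0) ->
  zariski_closure A v -> \det (\matrix_(i, j) M i j v) = 0.
Proof.
move=> hA clA; apply: (clA (fun w => \det (\matrix_(i, j) M i j w) = 0)) => //.
pose D := \det (\matrix_(i, j)
    \sum_(k < \dim {:V}) M i j (vbasis {:V})`_k *: 'X_k)
  : {mpoly K[_]}.
exists (eq D) => w.
suff -> : \det (\matrix_(i, j) M i j w) = eval_poly_fun D w.
  by split=> [Dw _ <- //|]; apply.
rewrite /eval_poly_fun -det_map_mx; congr (\det _); apply/matrixP => i j.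
by rewrite !mxE; apply: esym; apply: eval_linear_form.
Qed.

Lemma poly_eq0_off0 (p : {poly K}) : (forall t, t != 0 -> p.[t] = 0) -> p = 0.
Proof.
move=> p0; apply/eqP; apply: contraT => nz_p.
(* In characteristic zero 1, ..., [size p] are distinct nonzero roots, more than the degree
   allows. *)
have := @max_poly_roots _ p [seq i.+1%:R | i <- iota 0 (size p)] nz_p.
rewrite size_map size_iota ltnn => -> //.
  by apply/allP => _ /mapP[i _ ->]; rewrite rootE p0 ?pnatr_eq0.
rewrite map_inj_uniq ?iota_uniq // => i j /eqP.
by rewrite eqr_nat eqSS => /eqP.
Qed.

(** A polynomial vanishing on [A] pulls back to a polynomial in t that is zero for all t <> 0, hence
    identically; at t = 0 only the terms of exponent 0 remain. *)
Lemma zariski_closure_curve (I : finType) (k : I -> nat) (v : I -> V)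
    (A : V -> Prop) :
  (forall t : K, t != 0 -> A (\sum_i t ^+ k i *: v i)) ->
  zariski_closure A (\sum_(i | k i == 0%N) v i).
Proof.
move=> hA Z [J ZJ] AZ; apply/ZJ => f Jf.
pose P := mmap (@polyC K)
  (fun j => \sum_i coord (vbasis {:V}) j (v i) *: 'X^(k i)) f.
have Pt t : P.[t] = eval_poly_fun f (\sum_i t ^+ k i *: v i).
  rewrite /eval_poly_fun mevalE /P /mmap -horner_evalE raddf_sum.
  apply: eq_bigr => e _ /=.
  rewrite horner_evalE hornerM hornerC /mmap1 horner_prod.
  congr (_ * _); apply: eq_bigr => j _; rewrite horner_exp horner_sum.
  congr (_ ^+ _); rewrite raddf_sum; apply: eq_bigr => i _ /=.
  by rewrite hornerZ hornerXn linearZ mulrC.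
have P0 : P = 0.
  apply: poly_eq0_off0 => t nz_t; rewrite Pt; apply: (ZJ _).1 => //.
  exact/AZ/hA.
have := Pt 0; rewrite P0 horner0 => ->; congr eval_poly_fun.
rewrite big_mkcond; apply: eq_bigr => i _.
by rewrite expr0n; case: eqP; rewrite ?scale1r ?scale0r.
Qed.

End ZariskiClosure.

Lemma sum_of_powers_rank (K : fieldType) n d (phi : dhomog n.+1 K d) r :
  sum_of_powers phi r -> rank_at_most r phi.
Proof.
move=> hr; pose P := fun s => `[< sum_of_powers phi s >].
have exP : exists s, P s by exists r; apply/asboolP.
case: (ex_minnP exP) => s /asboolP hs mins.
exists s; first by apply: mins; apply/asboolP.
by split=> // s' hs'; apply: mins; apply/asboolP.
Qed.

(** * Catalecticant matrices *)

Section Catalecticant.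
Context (K : numFieldType) (n d : nat).
Implicit Types (e : 'X_{1..n.+1}) (phi : dhomog n.+1 K d).

(** For [e] of degree [d] this is the apolar pairing: the constant obtained by applying the
    differential operator of multidegree [e] to [phi]. *)
Definition apolar_coef e phi : K := (phi : {mpoly K[n.+1]})@_e *+ mfact e.

Lemma apolar_coef_linear e : scalar (apolar_coef e).
Proof.
move=> c p q; rewrite /apolar_coef (linearP (@mpoly_of_dhomog _ _ _)).
by rewrite mcoeffD mcoeffZ mulrnDl mulrnAr.
Qed.

HB.instance Definition _ e :=
  GRing.isLinear.Build K (dhomog n.+1 K d) K _ (apolar_coef e)
    (apolar_coef_linear e).

Lemma apolar_coef_sum_of_powers phi r : sum_of_powers phi r ->
  exists l : 'I_r -> 'I_n.+1 -> K, forall e, mdeg e = d ->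
    apolar_coef e phi = \sum_k (\prod_i l k i ^+ e i) *+ d`!.
Proof.
case=> l phiE; exists (fun k i => (l k : {mpoly K[n.+1]})@_U_(i)) => e de.
rewrite /apolar_coef phiE raddf_sum -sumrMnl; apply: eq_bigr => k _ /=.
by rewrite -mcoeff_linform_expr // -(dhomog1_linform (dhomog_is_dhomog (l k))).
Qed.

Lemma catalecticant_bound N (b c : 'I_N -> 'X_{1..n.+1}) phi s :
  (forall i j, mdeg (b i + c j)%MM = d) ->
  \det (\matrix_(i, j) apolar_coef (b i + c j)%MM phi) != 0 ->
  zariski_closure (rank_at_most s) phi -> (N <= s)%N.
Proof.
move=> dbc nz_det cl; rewrite leqNgt; apply: contra nz_det => ltsN; apply/eqP.
apply: (zariski_closure_det (M := fun i j => apolar_coef (b i + c j)%MM) _ cl).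
move=> w [r ler [/apolar_coef_sum_of_powers[l lE] _]].
(* Each power contributes a matrix of rank at most one, since l^(b+c) = l^b l^c; so the
   catalecticant factors through dimension [r] < [N]. *)
pose U := \matrix_(i < N, k < r) ((\prod_t l k t ^+ b i t) *+ d`!).
pose W := \matrix_(k < r, j < N) \prod_t l k t ^+ c j t.
have -> : \matrix_(i, j) apolar_coef (b i + c j)%MM w = U *m W.
  apply/matrixP => i j; rewrite !mxE lE //; apply: eq_bigr => k _.
  rewrite !mxE mulrnAl -big_split; congr (_ *+ _); apply: eq_bigr => t _.
  by rewrite mnmDE exprD.
apply/eqP; apply: contraTT (leq_ltn_trans ler ltsN) => detU.
rewrite -leqNgt -(mxrank_unit (A := U *m W)) ?mulmx_max_rank //.
by rewrite unitmxE unitfE.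
Qed.

End Catalecticant.

(** * Boxes of exponents and moment weights *)

(** The common bound [D] gives the finite functions a single codomain, while the actual bound [c i]
    varies with [i]. *)
Definition box n D (c : 'I_n -> nat) : {pred {ffun 'I_n -> 'I_D.+1}} :=
  family (fun i => [pred j : 'I_D.+1 | j <= c i]%N).
Arguments box {n} D c.

(** Stated for abstract operations to serve both for counting the box in [nat] and for factoring
    weighted sums in [K]. *)
Lemma box_distr (A : Type) (zero one : A) (times : Monoid.mul_law zero)
    (plus : Monoid.add_law zero times) n D (c : 'I_n -> nat)
    (F : 'I_n -> nat -> A) : (forall i, c i <= D)%N ->
  \big[plus/zero]_(J in box D c) \big[times/one]_i F i (J i)
  = \big[times/one]_i \big[plus/zero]_(j < (c i).+1) F i j.
Proof.
move=> cD; rewrite -(bigA_distr_big_dep (fun i => [pred j : 'I_D.+1 | j <= c i]%N)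
  (fun i (j : 'I_D.+1) => F i j)); apply: eq_bigr => i _.
by rewrite (big_ord_widen D.+1 (F i)) ?ltnS.
Qed.

Lemma card_box n D (c : 'I_n -> nat) : (forall i, c i <= D)%N ->
  #|box D c| = (\prod_i (c i).+1)%N.
Proof.
move=> cD; rewrite -sum1_card.
have := @box_distr nat 0%N 1%N muln addn n D c (fun _ _ => 1%N) cD.
rewrite (eq_bigr (fun=> 1%N)) => [->|J _]; last exact: big1.
by apply: eq_bigr => i _; rewrite sum1_card card_ord.
Qed.

(** The conditions form a Vandermonde system at the distinct nodes 1, ..., k+1; the weights are the
    last column of the inverse matrix. *)
Lemma moment_weights (K : numFieldType) k : exists w : nat -> K,
  forall b, (b <= k)%N -> \sum_(j < k.+1) w j * j.+1%:R ^+ b = (b == k)%:R.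
Proof.
pose A : 'M[K]_k.+1 := Vandermonde k.+1 (\row_j j.+1%:R).
have uA : A \in unitmx.
  rewrite unitmxE unitfE det_Vandermonde; apply/prodf_neq0 => i _.
  apply/prodf_neq0 => j ltij; rewrite !mxE subr_eq0 eqr_nat eqSS.
  by rewrite gtn_eqF.
pose u := invmx A *m (delta_mx ord_max 0 : 'cV_k.+1).
exists (fun j => u (inord j) 0) => b leb.
have := congr1 (fun v : 'cV_k.+1 => v (inord b) 0)
  (mulKVmx uA (delta_mx ord_max 0 : 'cV_k.+1)).
rewrite -/u !mxE andbT -val_eqE /= inordK // => <-.
by apply: eq_bigr => j _; rewrite !mxE inord_val inordK // mulrC.
Qed.

(** Zeroing the exponent of x_0 leaves one choice there, so products may run over all indices. *)
Definition tail n (a : 'I_n.+1 -> nat) (i : 'I_n.+1) : nat :=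
  if i == ord0 then 0%N else a i.

Lemma tail_le_mdeg n (a : 'X_{1..n.+1}) i : (tail a i <= mdeg a)%N.
Proof. by rewrite /tail; case: ifP => // _; rewrite mdegE (bigD1 i) ?leq_addr. Qed.

Lemma mdeg_recl n (a : 'X_{1..n.+1}) :
  mdeg a = (a ord0 + \sum_(i | i != ord0) a i)%N.
Proof. by rewrite mdegE (bigD1 ord0). Qed.

Lemma card_tail_box n (a : 'X_{1..n.+1}) :
  #|box (mdeg a) (tail a)| = (\prod_(i | i != ord0) (1 + a i))%N.
Proof.
rewrite card_box; last exact: tail_le_mdeg.
rewrite (bigD1 ord0) //= /tail eqxx mul1n; apply: eq_bigr => i /negbTE ->.
by rewrite add1n.
Qed.

Lemma box_ord0 n D (a : 'I_n.+1 -> nat) J :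
  J \in box D (tail a) -> J ord0 = ord0.
Proof.
by move=> /familyP/(_ ord0); rewrite inE /tail eqxx leqn0 => /eqP J0; apply: val_inj.
Qed.

Lemma box_le n D (a : 'I_n.+1 -> nat) J i :
  J \in box D (tail a) -> i != ord0 -> (J i <= a i)%N.
Proof. by move=> /familyP/(_ i); rewrite inE /tail => + /negbTE i0; rewrite i0. Qed.

(* The monomials y^b of degree a_1 + ... + a_m dividing x^a: hypothesis
   a_1 + ... + a_m <= a_0 leaves their exponents b_1, ..., b_m unconstrained. *)
Definition box_mnm n (a : 'X_{1..n.+1}) (J : {ffun 'I_n.+1 -> 'I_(mdeg a).+1}) :
    'X_{1..n.+1} :=
  [multinom if i == ord0
            then (\sum_(j | j != ord0) a j - \sum_(j | j != ord0) J j)%N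
            else J i | i < n.+1].

Section BoxMonomials.
Context (n : nat) (a : 'X_{1..n.+1}).
Hypothesis ha : (\sum_(i | i != ord0) a i <= a ord0)%N.

Lemma box_mnm_le J : J \in box (mdeg a) (tail a) -> (box_mnm J <= a)%MM.
Proof.
move=> JB; apply/mnm_lepP => i; rewrite mnmE; case: eqP => [->|/eqP i0].
  exact: leq_trans (leq_subr _ _) ha.
exact: box_le JB i0.
Qed.

Lemma mdeg_box_mnm J : J \in box (mdeg a) (tail a) ->
  mdeg (box_mnm J) = (\sum_(i | i != ord0) a i)%N.
Proof.
move=> JB; rewrite mdeg_recl mnmE eqxx.
rewrite [X in (_ + X)%N](eq_bigr (fun i => nat_of_ord (J i))); last first.
  by move=> i /negbTE i0; rewrite mnmE i0.
by rewrite subnK //; apply: leq_sum => i; apply: box_le.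
Qed.

Lemma box_mnm_inj : {in box (mdeg a) (tail a) &, injective (@box_mnm n a)}.
Proof.
move=> J J' JB J'B /mnmP eqJ; apply/ffunP => i.
have [->|i0] := eqVneq i ord0; first by rewrite (box_ord0 JB) (box_ord0 J'B).
by have := eqJ i; rewrite !mnmE (negbTE i0) => /val_inj.
Qed.

End BoxMonomials.

(** * Lower bound for the monomial *)

Lemma border_rank_monomial_ge (K : numFieldType) n d (a : 'X_{1..n.+1})
    (phi : dhomog n.+1 K d) s :
  mdeg a = d -> (phi : {mpoly K[n.+1]}) = 'X_[a] ->
  (\sum_(i | i != ord0) a i <= a ord0)%N ->
  zariski_closure (rank_at_most s) phi ->
  (\prod_(i | i != ord0) (1 + a i) <= s)%N.
Proof.
move=> da phiE ha; rewrite -card_tail_box.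
set B := box _ _.
pose b (k : 'I_#|B|) := box_mnm (enum_val k).
have ble k : (b k <= a)%MM by apply/box_mnm_le/enum_valP.
have bE k : mdeg (b k) = (\sum_(i | i != ord0) a i)%N.
  exact/mdeg_box_mnm/enum_valP.
apply: (@catalecticant_bound _ _ _ _ b (fun k => a - b k)%MM) => [i j|].
  by rewrite mdegD bE -(bE j) -mdegD addmC submK.
rewrite (_ : \matrix_(i, j) _ = (mfact a)%:R%:M).
  by rewrite det_scalar expf_neq0 // pnatr_eq0 -lt0n mfact_gt0.
apply/matrixP => i j; rewrite !mxE /apolar_coef phiE mcoeffX.
(* After cancelling a - b_j, the (i, j) entry is nonzero only if b_i = b_j, that is i = j. *)
rewrite -{1}(submK (ble j)) [(b i + _)%MM]addmC eqm_add2l.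
rewrite (inj_in_eq (@box_mnm_inj _ a)) ?enum_valP //.
rewrite (inj_eq enum_val_inj) eq_sym; case: eqP => [->|_]; last by rewrite mul0rn.
by rewrite submK.
Qed.

(** * Upper bound for the monomial *)

Lemma linform_homog n (A : nzRingType) (l : 'I_n -> A) :
  (\sum_i l i *: 'X_i : {mpoly A[n]}) \is 1.-homog.
Proof.
by apply: rpred_sum => i _; apply: rpredZ; rewrite dhomogX; apply/eqP/mdeg1.
Qed.

(** Each weight is absorbed into its linear form through a [d]-th root. *)
Lemma weighted_sum_of_powers (K : numClosedFieldType) n d
    (phi : dhomog n.+1 K d) (I : finType) (B : {pred I}) (c : I -> K)
    (l : I -> 'I_n.+1 -> K) : (0 < d)%N ->
  (phi : {mpoly K[n.+1]})
    = \sum_(x in B) c x *: (\sum_i l x i *: 'X_i) ^+ d ->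
  sum_of_powers phi #|B|.
Proof.
rewrite /sum_of_powers => d_gt0 ->; rewrite big_enum_val.
exists (fun k => d.-root (c (enum_val k))
                   *: DHomog (linform_homog (l (enum_val k)))).
by apply: eq_bigr => k _; rewrite linearZ exprZn rootCK.
Qed.

(** [indhomog] defaults to 0 on monomials of degree other than [d], so their terms vanish. *)
Lemma mcoeff_sum_monomials (K : fieldType) n d (g : 'X_{1..n} -> K) e :
  (mpoly_of_dhomog
    (\sum_(f : 'X_{1..n < d.+1}) g f *: indhomog d 'X_[f]))@_e
  = if mdeg e == d then g e else 0.
Proof.
rewrite !raddf_sum /=.
have vE (f : 'X_{1..n < d.+1}) : (mpoly_of_dhomog (g f *: indhomog d 'X_[f]))@_e
    = if (mdeg f == d) && (bmnm f == e) then g e else 0.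
  rewrite -[LHS]/((g f *: mpoly_of_dhomog (indhomog d 'X_[f]))@_e) mcoeffZ.
  rewrite -[mpoly_of_dhomog _]/(val _) val_insubd dhomogX.
  case: ifP => _; last by rewrite mcoeff0 mulr0.
  by rewrite mcoeffX; case: eqP => [->|_]; rewrite ?mulr1 ?mulr0.
under eq_bigr do rewrite vE.
rewrite -big_mkcond /=; case: ifP => [/eqP de|de].
  have ltd : (mdeg e < d.+1)%N by rewrite de.
  rewrite (big_pred1 (BMultinom ltd)) // => f.
  rewrite -[RHS]val_eqE /=; case: (bmnm f =P e) => [->|_].
    by rewrite de eqxx.
  by rewrite andbF.
rewrite big_pred0 // => f; case: (bmnm f =P e) => [->|]; by rewrite ?de ?andbF.
Qed.

(** Domination together with the bound on the sum forces equality off index 0; the degree then fixes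
    the exponent of x_0. This singles out x^a in the limit t = 0. *)
Lemma mnm_eq_of_tail n (a e : 'X_{1..n.+1}) : mdeg e = mdeg a ->
  (forall i, (tail a i <= e i)%N) ->
  (\sum_(i | i != ord0) e i <= \sum_(i | i != ord0) a i)%N -> e = a.
Proof.
move=> dea lea les.
have lea' i : i != ord0 -> (a i <= e i)%N.
  by move=> /negbTE i0; have := lea i; rewrite /tail i0.
have sumE : (\sum_(i | i != ord0) a i = \sum_(i | i != ord0) e i)%N.
  by apply/eqP; rewrite eqn_leq les leq_sum.
have := leqif_sum (fun i i0 => leqif_eq (lea' i i0)).
move=> [_]; rewrite sumE eqxx => /esym/forall_inP eqi.
apply/mnmP => i; have [->|/eqi/eqP//] := eqVneq i ord0.
by move: dea; rewrite !mdeg_recl sumE => /addIn.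
Qed.

Lemma border_rank_monomial_le (K : numClosedFieldType) n d (a : 'X_{1..n.+1})
    (phi : dhomog n.+1 K d) :
  mdeg a = d -> (phi : {mpoly K[n.+1]}) = 'X_[a] ->
  zariski_closure (rank_at_most (\prod_(i | i != ord0) (1 + a i))%N) phi.
Proof.
move=> da phiE; have [d0|d_gt0] := posnP d.
  move=> Z _; apply; apply: sum_of_powers_rank.
  have a0 : a = 0%MM by apply/eqP; rewrite -mdeg_eq0 da d0.
  rewrite big1 => [|i _]; last by rewrite a0 mnm0E.
  (* In degree 0 the monomial is 1, the single power 0^0. *)
  by exists (fun=> 0); rewrite phiE a0 mpolyX0 big_ord1 d0 expr0.
have /fin_all_exists[w wE] := fun i => moment_weights K (tail a i).
pose M i b := \sum_(j < (tail a i).+1) w i j * j.+1%:R ^+ b.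
have M_neq0 (e : 'X_{1..n.+1}) :
    \prod_i M i (e i) != 0 -> forall i, (tail a i <= e i)%N.
  move=> /prodf_neq0 nzM i; have := nzM i isT; apply: contraR.
  by rewrite -ltnNge => lti; rewrite /M wE ?(ltnW lti) // ltn_eqF.
have M_a : \prod_i M i (a i) = 1.
  rewrite big1 // => i _; have [->|i0] := eqVneq i ord0.
    have := wE ord0 0%N (leq0n _); rewrite /M /tail eqxx !big_ord1 expr0.
    by rewrite expr1n => ->.
  by rewrite /M wE /tail (negbTE i0) ?eqxx.
pose A := (\sum_(i | i != ord0) a i)%N.
pose T (e : 'X_{1..n.+1}) := (\sum_(i | i != ord0) e i)%N.
(* The coefficient of x^e on the curve is t^(T e - A) times [g e]; the factor a! normalizes [g a] to
   1. *)
pose g (e : 'X_{1..n.+1}) : K :=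
  (\prod_i M i (e i)) * (mfact a)%:R / (mfact e)%:R.
have nz_mfact (e : 'X_{1..n.+1}) : (mfact e)%:R != 0 :> K.
  by rewrite pnatr_eq0 -lt0n mfact_gt0.
(* The truncation in [T e - A] is harmless: [g e = 0] when [T e < A]. *)
have phi_lim : phi = \sum_(e : 'X_{1..n.+1 < d.+1} | (T e - A == 0)%N)
    g e *: indhomog d 'X_[e].
  rewrite big_mkcond.
  rewrite (eq_bigr (fun e : 'X_{1..n.+1 < d.+1} =>
    (((T e - A)%N == 0%N)%:R * g e) *: indhomog d 'X_[e])); last first.
    by move=> e _; case: eqP; rewrite ?mul1r // mul0r scale0r.
  apply: val_inj; apply/mpolyP => e.
  rewrite [RHS](@mcoeff_sum_monomials _ _ _
    (fun e => ((T e - A)%N == 0%N)%:R * g e)).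
  rewrite /= phiE mcoeffX; case: ifP => [/eqP de|de]; last first.
    by case: (a =P e) de => [<-|]; rewrite ?da ?eqxx.
  have [<-|nae] := eqVneq; first by rewrite /T subnn eqxx mul1r /g M_a mul1r divff.
  case: eqP => [/eqP TA|_]; last by rewrite mul0r.
  rewrite /g; have [->|nzM] := eqVneq (\prod_i M i (e i)) 0.
    by rewrite !mul0r mulr0.
  case/eqP: nae; apply/esym/mnm_eq_of_tail; first by rewrite da.
    exact: M_neq0.
  by rewrite -subn_eq0.
rewrite phi_lim; apply: zariski_closure_curve => t nz_t.
apply: sum_of_powers_rank; rewrite -card_tail_box.
pose c (J : {ffun 'I_n.+1 -> 'I_(mdeg a).+1}) : K :=
  (\prod_i w i (J i)) * ((mfact a)%:R / (t ^+ A * d`!%:R)).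
(* On the box J_0 = 0, so x_0 has coefficient 1, and the uniform factor J_i + 1 lets the sum over
   [J] split into moments. *)
pose l (J : {ffun 'I_n.+1 -> 'I_(mdeg a).+1}) (i : 'I_n.+1) : K :=
  (if i == ord0 then 1 else t) * (J i).+1%:R.
apply: (@weighted_sum_of_powers _ _ _ _ _ _ c l) => //.
apply/mpolyP => e; under eq_bigr do rewrite scalerA.
rewrite (@mcoeff_sum_monomials _ _ _ (fun e => t ^+ (T e - A) * g e)) raddf_sum /=.
case: ifP => [/eqP de|/negbT de]; last first.
  apply/esym/big1 => J _.
  have hl := dhomogMn d (linform_homog (l J)); rewrite mul1n in hl.
  by rewrite mcoeffZ (dhomog_nemf_coeff hl de) mulr0.
have lE J : (c J *: (\sum_i l J i *: 'X_i) ^+ d)@_e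
    = (\prod_i (w i (J i) * (J i).+1%:R ^+ e i))
      * (t ^+ T e / t ^+ A * (mfact a)%:R / (mfact e)%:R).
  have nz_d : d`!%:R != 0 :> K by rewrite pnatr_eq0 -lt0n fact_gt0.
  have prod_l : \prod_i l J i ^+ e i = t ^+ T e * \prod_i (J i).+1%:R ^+ e i.
    under eq_bigr do rewrite exprMn.
    rewrite big_split (bigD1 ord0) //= expr1n mul1r /T expr_sum; congr (_ * _).
    by apply: eq_bigr => i /negbTE ->.
  have := mcoeff_linform_expr (l J) de.
  rewrite -[LHS]mulr_natr -[RHS]mulr_natr prod_l => /(canRL (mulfK (nz_mfact e))).
  rewrite mcoeffZ /c big_split => ->.
  have : t ^+ A != 0 by rewrite expf_neq0.
  move: nz_d (nz_mfact e); move: d`!%:R (mfact e)%:R (mfact a)%:R (t ^+ A).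
  move: (t ^+ T e) (\prod_i w i (J i)) (\prod_i (J i).+1%:R ^+ e i) => u x y D E F v.
  by move=> nzD nzE nzv /=; field; rewrite nzD nzE nzv.
under eq_bigr do rewrite lE.
have sumE : \sum_(J in box (mdeg a) (tail a))
    \prod_i (w i (J i) * (J i).+1%:R ^+ e i) = \prod_i M i (e i).
  exact: (box_distr 1 _ (fun i j => w i j * j.+1%:R ^+ e i) (tail_le_mdeg a)).
rewrite -mulr_suml sumE /g.
(* If the product of moments is nonzero then A <= T e, so the truncated exponent agrees with the
   quotient t^(T e) / t^A. *)
have [->|nzM] := eqVneq (\prod_i M i (e i)) 0; first by rewrite !mul0r mulr0.
rewrite expfB_cond.
  by rewrite -[_ * _ / _ in LHS]mulrA mulrCA !mulrA.
rewrite (negbTE nz_t) add0n; apply: leq_sum => i i0.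
by have := M_neq0 _ nzM i; rewrite /tail (negbTE i0).
Qed.

(** * Both bounds combined over the complex numbers *)

Theorem theorem1p1 (R : realType) (m : nat) (a : 'I_m.+1 -> nat)
    (ha : (\sum_(i < m.+1 | i != ord0) a i <= a ord0)%N) :
  has_border_rank (monomial (complex R) a)
    (\prod_(i < m.+1 | i != ord0) (1 + a i))%N.
Proof.
pose e := [multinom a i | i < m.+1].
have eE i : e i = a i by rewrite mnmE.
have de : mdeg e = (\sum_(i < m.+1) a i)%N.
  by rewrite mdegE; apply: eq_bigr => i _.
have monE : (monomial (complex R) a : {mpoly (complex R)[m.+1]}) = 'X_[e].
  by rewrite mpolyXE_id; apply: eq_bigr => i _; rewrite eE.
have prodE : (\prod_(i < m.+1 | i != ord0) (1 + a i)
    = \prod_(i < m.+1 | i != ord0) (1 + e i))%N.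
  by apply: eq_bigr => i _; rewrite eE.
rewrite prodE; split; first exact: border_rank_monomial_le.
move=> s; apply: border_rank_monomial_ge => //.
by rewrite eE; under eq_bigr do rewrite eE.
Qed.
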